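(* Let $P_i\sim\mathrm{Uniform}(0,1)$ for $i=1,\dots,d$, let $F(x)=\exp(-1/x)$, $x>0$, and suppose that $X=(X_i)_{i=1}^d$ with $X_i=F^{-1}(1-P_i)=-1/\log(1-P_i)$ is multivariate regularly varying. Then Tippett's method (the Dunn–Šidák correction), which rejects at level $\alpha\in(0,1)$ when $P_{\min}:=\min_{1\le i\le d}P_i<t_\alpha:=1-\exp\{d^{-1}\log(1-\alpha)\}$, is honest, i.e. $$\limsup_{\alpha\downarrow 0}\alpha^{-1}\Pr(P_{\min}<t_\alpha)\le 1.$$ Further, it is conservative, i.e. $$\limsup_{\alpha\downarrow 0}\alpha^{-1}\Pr(P_{\min}<t_\alpha)<1,$$ except when the copula between every pair of $P_1,\dots,P_d$ is lower-tail independent, i.e. $\lim_{p\downarrow 0}\Pr(P_i\le p\mid P_j\le p)=0$ for all $i\ne j$.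
   Context: Multivariate regular variation: a random vector $X$ in $\mathbb{R}^d$ is multivariate regularly varying if there exist a positive function $b(t)\to\infty$ and a non-zero Borel measure $\mu$ on $\mathbb{R}^d\setminus\{0\}$, finite on Borel sets bounded away from $0$, such that $b(t)\Pr(X\in tA)\to\mu(A)$ as $t\to\infty$ for all Borel sets $A\subset\mathbb{R}^d\setminus\{0\}$ that are bounded away from $0$ and satisfy $\mu(\partial A)=0$. *)

(* Defs.v *)
(* MathComp-Analysis. *)
From HB Require Import structures.
From mathcomp Require Import all_boot all_order all_algebra.
From mathcomp Require Import all_classical all_reals all_analysis.

Set Implicit Arguments.
Unset Strict Implicit.
Unset Printing Implicit Defensive.

Import Order.TTheory GRing.Theory Num.Theory.
Import numFieldNormedType.Exports.

Local Open Scope classical_set_scope.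
Local Open Scope ring_scope.

(* R^d with its Borel sigma-algebra; random vectors are {RV Pr >-> borel_rV R d}. *)
Definition borel_rV (R : realType) (d : nat) :=
  g_sigma_algebraType (@open 'rV[R]_d).

(* The norm on 'rV[R]_d is the sup norm; any other norm gives the same notion. *)
Definition bounded_away_from0 (R : realType) (d : nat) (A : set 'rV[R]_d) :=
  exists2 e : R, 0 < e & forall x, A x -> e <= `|x|.

Definition frontier (T : topologicalType) (A : set T) : set T :=
  closure A `\` A°.

Definition dilate (R : realType) (d : nat) (t : R) (A : set 'rV[R]_d) :
  set 'rV[R]_d := [set t *: x | x in A].

(* A Borel measure on R^d \ {0} is encoded as its extension by zero, i.e. a
   Borel measure mu on R^d with mu {0} = 0.  A set bounded away from 0 lies in
   R^d \ {0}, and its frontiers in R^d \ {0} and in R^d coincide. *)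
Definition multivariate_regularly_varying (disp : measure_display)
    (T : measurableType disp) (R : realType) (Pr : probability T R) (d : nat)
    (X : {RV Pr >-> borel_rV R d}) : Prop :=
  exists (b : R -> R) (mu : {measure set (borel_rV R d) -> \bar R}),
    (forall t, 0 < t -> 0 < b t) /\
    (b t @[t --> +oo] --> +oo) /\
    mu [set 0] = 0%E /\
    mu [set: borel_rV R d] != 0%E /\
    (forall A : set (borel_rV R d), measurable A -> bounded_away_from0 A ->
       (mu A < +oo)%E) /\
    (forall A : set (borel_rV R d), measurable A -> bounded_away_from0 A ->
       mu (frontier (A : set 'rV[R]_d)) = 0%E ->
       ((b t)%:E * Pr (X @^-1` dilate t A))%E @[t --> +oo] --> mu A).

Definition frechet_cdf (R : realType) (x : R) : R := expR (- x^-1).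

Definition frechet_quantile (R : realType) (q : R) : R := - (ln q)^-1.

Lemma frechet_quantile_gt0 (R : realType) (q : R) :
  0 < q < 1 -> 0 < frechet_quantile q.
Proof. by move=> q01; rewrite oppr_gt0 invr_lt0 ln_lt0. Qed.

Lemma frechet_quantileK (R : realType) (q : R) :
  0 < q < 1 -> frechet_cdf (frechet_quantile q) = q.
Proof.
move=> /andP[q0 _].
by rewrite /frechet_cdf /frechet_quantile invrN invrK opprK lnK.
Qed.

Lemma frechet_cdfK (R : realType) (x : R) :
  0 < x -> frechet_quantile (frechet_cdf x) = x.
Proof. by move=> _; rewrite /frechet_quantile expRK invrN invrK opprK. Qed.

(* Equality is required on Borel sets only: both sides are also defined, but
   meaningless, on the other sets. *)
Definition uniform01 (disp : measure_display) (T : measurableType disp)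
    (R : realType) (Pr : probability T R) (U : {RV Pr >-> R}) : Prop :=
  forall B : set R, measurable B ->
    distribution Pr U B = uniform_prob (@ltr01 R) B.

(* For 0 < d the range is finite and nonempty, so the infimum is the minimum. *)
Definition pmin (T : Type) (R : realType) (d : nat) (P : 'I_d -> T -> R)
  (w : T) : R := inf (range (fun i => P i w)).

Definition sidak_threshold (R : realType) (d : nat) (a : R) : R :=
  1 - expR (d%:R^-1 * ln (1 - a)).

Definition tippett_reject (T : Type) (R : realType) (d : nat)
  (P : 'I_d -> T -> R) (a : R) : set T :=
  [set w | pmin P w < sidak_threshold d a].

Definition relative_size (disp : measure_display) (T : measurableType disp)
    (R : realType) (Pr : probability T R) (reject : R -> set T) : \bar R :=
  limf_esup (fun a : R => (a^-1%:E * Pr (reject a))%E) (0 : R)^'+.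

Definition honest (disp : measure_display) (T : measurableType disp)
    (R : realType) (Pr : probability T R) (reject : R -> set T) : Prop :=
  (relative_size Pr reject <= 1)%E.

Definition conservative (disp : measure_display) (T : measurableType disp)
    (R : realType) (Pr : probability T R) (reject : R -> set T) : Prop :=
  (relative_size Pr reject < 1)%E.

Definition cond_prob (disp : measure_display) (T : measurableType disp)
    (R : realType) (Pr : probability T R) (A B : set T) : R :=
  fine (Pr (A `&` B)) / fine (Pr B).

Definition lower_tail_independent (disp : measure_display)
    (T : measurableType disp) (R : realType) (Pr : probability T R)
    (U V : {RV Pr >-> R}) : Prop :=
  cond_prob Pr [set w | U w <= p] [set w | V w <= p] @[p --> 0^'+] --> (0 : R).

(* Main.v *)
(** The union bound gives honesty, because [d * t_alpha ~ alpha]; Bonferroni's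
    lower bound shows that the ratio tends to 1 when all pairs are lower-tail
    independent.  For the converse, regular variation enters only through one
    level [s] at which both [{|x| > s}] and [{min(x_i, x_j) > s}] have a
    [mu]-null frontier and [mu {|x| > s} > 0].  Dividing the two limits at
    [t = F^-1(1 - p) / s] cancels the normalisation [b], so
    [Pr(P_i < p, P_j < p) / Pr(|X| > F^-1(1 - p))] converges as [p -> 0+], and
    its denominator lies between [p] and [d * p].  Hence either the pair is
    lower-tail independent, or the joint tail is at least [c * p] for small
    [p], and this overlap is lost in the union bound. *)
Require Import Defs.
From HB Require Import structures.
From mathcomp Require Import all_boot all_order all_algebra.
From mathcomp Require Import all_classical all_reals all_analysis.
From mathcomp Require Import finmap ring lra.

Import Order.TTheory GRing.Theory Num.Theory.
Import numFieldNormedType.Exports.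

Local Open Scope classical_set_scope.
Local Open Scope ring_scope.

Set Implicit Arguments.
Unset Strict Implicit.

(** * Disjoint sets of positive measure, and uncountable intervals *)

Lemma measure_le (disp : measure_display) (T : measurableType disp)
    (R : realType) (mu : {measure set T -> \bar R}) (A B : set T) :
  measurable A -> measurable B -> A `<=` B -> (mu A <= mu B)%E.
Proof. by move=> mA mB; apply: le_measure; exact: mem_set. Qed.

(** Disjoint subsets of [C] of measure at least [1/(n+1)] number at most [(n+1) * mu C], hence are
    finite in number for each [n]; the non-null members are the union of these finite families. *)
Lemma countable_nonnull (disp : measure_display) (T : measurableType disp)
    (R : realType) (mu : {measure set T -> \bar R}) (I : choiceType)
    (D : set I) (F : I -> set T) (C : set T) :
  measurable C -> (mu C < +oo)%E -> trivIset D F ->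
  (forall i, D i -> measurable (F i)) -> (forall i, D i -> F i `<=` C) ->
  countable [set i | D i /\ mu (F i) != 0%E].
Proof.
move=> mC Cfin tF mF FC.
have Cfn : mu C \is a fin_num by rewrite ge0_fin_numE.
have -> : [set i | D i /\ mu (F i) != 0%E] =
    \bigcup_n [set i | D i /\ (n.+1%:R^-1%:E <= mu (F i))%E].
  apply/seteqP; split=> [i [Di Fi]|i [n _ [Di Fi]]]; last first.
    by split=> //; rewrite gt_eqF// (lt_le_trans _ Fi)// lte_fin invr_gt0.
  have Fi0 : (0 < mu (F i))%E by rewrite lt0e Fi measure_ge0.
  have Ffin : mu (F i) \is a fin_num.
    rewrite ge0_fin_numE// (le_lt_trans _ Cfin)//.
    by apply: measure_le => //; [exact: mF|exact: FC].
  have f0 : 0 < fine (mu (F i)) by rewrite fine_gt0// Fi0 -ge0_fin_numE.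
  (* With [n] the integer part of [1 / mu (F i)], [n+1] exceeds [1 / mu (F i)]. *)
  exists (Num.truncn (fine (mu (F i)))^-1) => //; split => //.
  rewrite -[leRHS]fineK// lee_fin invf_ple ?posrE//.
  by rewrite ltW// truncnS_gt.
apply: bigcup_countable => // n _; apply: finite_set_countable.
apply: contrapT.
(* An infinite family would contain this many members, of total measure at least
   [truncn (mu C) + 1], which exceeds [mu C]. *)
move=> /(@infinite_set_fset _ _ (n.+1 * (Num.truncn (fine (mu C))).+1))
  [B BA leB].
have : (\sum_(i \in [set` B]) mu (F i) <= mu C)%E.
  rewrite -measure_fin_bigcup//.
  - apply: measure_le => //.
      by apply: fin_bigcup_measurable => // i /BA [Di _]; exact: mF.
    by apply: bigcup_sub => i /BA [Di _]; exact: FC.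
  - by apply: sub_trivIset tF => i /BA[].
  - by move=> i /BA [Di _]; exact: mF.
apply/negP; rewrite -ltNge.
apply: (@lt_le_trans _ _ (\sum_(i <- B) n.+1%:R^-1%:E)%E).
  rewrite sumEFin big_const_seq iter_addr_0 count_predT.
  rewrite -[X in (X < _)%E]fineK// lte_fin -[ltRHS]mulr_natr.
  apply: (@lt_le_trans _ _ (Num.truncn (fine (mu C))).+1%:R).
    exact: truncnS_gt.
  by rewrite ler_pdivlMl// -natrM ler_nat.
rewrite fsbig_finite//= set_fsetK big_seq [leRHS]big_seq.
by apply: lee_sum => i iB; have [] := BA i iB.
Qed.

Lemma uncountable_itvoo (R : realType) (a b : R) :
  a < b -> ~ countable [set` `]a, b[].
Proof.
move=> ab /countable_lebesgue_measure0.
rewrite lebesgue_measure_itv/= lte_fin ab -EFinB => -[] /eqP.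
by rewrite subr_eq0 gt_eqF.
Qed.

(** * Frontiers of superlevel sets, and Borel sets of R^d *)

Lemma open_superlevel (R : realType) (T : topologicalType) (f : T -> R)
    (s : R) :
  continuous f -> open [set x | s < f x].
Proof.
by move=> cf; apply: (@open_comp _ _ f [set y | s < y]) => [y _|];
  [exact: cf|exact: open_gt].
Qed.

(** The set is open and its closure stays in [{s <= f}]. Equality can fail, for instance at a local
    maximum of value [s]. *)
Lemma frontier_superlevel (R : realType) (T : topologicalType) (f : T -> R)
    (s : R) : continuous f ->
  frontier [set x | s < f x] `<=` [set x | f x = s].
Proof.
move=> cf x [cx ix]; apply/eqP; rewrite eq_le; apply/andP; split.
- rewrite leNgt; apply/negP => sfx; apply: ix.
  by have := @open_superlevel _ _ _ s cf; rewrite openE => /(_ x sfx).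
- have : closed [set x | s <= f x].
    by apply: (@preimage_closed _ _ f [set y | s <= y]) => [y _|];
      [exact: cf|exact: closed_ge].
  move/closure_id => clE; suff : [set y | s <= f y] x by [].
  rewrite clE; apply: closureS cx => y /=; exact: ltW.
Qed.

Lemma open_measurable_rV (R : realType) (d : nat) (A : set 'rV[R]_d) :
  open A -> measurable (A : set (borel_rV R d)).
Proof.
by move=> oA; apply: (@sub_sigma_algebra 'rV[R]_d setT (@open 'rV[R]_d)).
Qed.

Lemma closed_measurable_rV (R : realType) (d : nat) (A : set 'rV[R]_d) :
  closed A -> measurable (A : set (borel_rV R d)).
Proof.
move=> cA; rewrite -[A]setCK; apply: measurableC.
by apply: open_measurable_rV; exact: closed_openC.
Qed.

Lemma frontier_measurable_rV (R : realType) (d : nat) (A : set 'rV[R]_d) :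
  measurable (frontier A : set (borel_rV R d)).
Proof.
apply: measurableD.
  by apply: closed_measurable_rV; exact: closed_closure.
by apply: open_measurable_rV; exact: open_interior.
Qed.

Lemma level_measurable_rV (R : realType) (d : nat) (f : 'rV[R]_d -> R) (s : R) :
  continuous f -> measurable ([set x | f x = s] : set (borel_rV R d)).
Proof.
move=> cf; apply: closed_measurable_rV.
apply: (@preimage_closed _ _ f [set s]) => [y _|]; first exact: cf.
exact: closed_eq.
Qed.

(** * Levels whose frontier is a null set *)

Section null_levels.
Context (R : realType) (d : nat) (mu : {measure set (borel_rV R d) -> \bar R}).
Hypothesis mufin : forall A : set (borel_rV R d), measurable A ->
  bounded_away_from0 A -> (mu A < +oo)%E.

(** Distinct levels are disjoint, and those above [a] lie in [{a < f}], which is bounded away from 0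
    because [f x <= |x|] and so has finite measure. *)
Lemma countable_nonnull_levels (f : 'rV[R]_d -> R) (a : R) : 0 < a ->
  continuous f -> (forall x, f x <= `|x|) ->
  countable [set s | a < s /\ mu [set x | f x = s] != 0%E].
Proof.
move=> a0 cf fx.
apply: (@countable_nonnull _ _ _ mu _ [set s | a < s]
  (fun s => [set x | f x = s]) [set x | a < f x]).
- by apply: open_measurable_rV; exact: open_superlevel.
- apply: mufin; first by apply: open_measurable_rV; exact: open_superlevel.
  by exists a => // x /= /ltW /le_trans; apply.
- by move=> s t _ _ [x [/= -> ->]].
- by move=> s _; exact: level_measurable_rV.
- by move=> s /= sa x /= ->.
Qed.

(** The bad levels of [f] and of [g] above [e / 2] are countable, so they cannot exhaust []e / 2,
    e[]. The bound [s < e] later keeps positive mass in [{|x| > s}]. *)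
Lemma common_null_frontier (f g : 'rV[R]_d -> R) (e : R) : 0 < e ->
  continuous f -> continuous g ->
  (forall x, f x <= `|x|) -> (forall x, g x <= `|x|) ->
  exists2 s, 0 < s < e &
    mu (frontier [set x | s < f x]) = 0%E /\
    mu (frontier [set x | s < g x]) = 0%E.
Proof.
move=> e0 cf cg fx gx.
have e20 : 0 < e / 2 by rewrite divr_gt0.
have := @uncountable_itvoo R (e / 2) e.
rewrite ltr_pdivrMr// ltr_pMr// ltr1n => /(_ isT) unc.
have : ~ ([set` `]e / 2, e[] `<=`
    [set s | e / 2 < s /\ mu [set x | f x = s] != 0%E] `|`
    [set s | e / 2 < s /\ mu [set x | g x = s] != 0%E]).
  move=> sub; apply: unc; apply: sub_countable (subset_card_le sub) _.
  rewrite -bigcup2E; apply: bigcup_countable => // -[|[|n]] _ /=.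
  - exact: countable_nonnull_levels.
  - exact: countable_nonnull_levels.
  - exact: countable0.
move=> /existsNP[s /not_implyP[]]; rewrite /= in_itv/= => /andP[es se].
move=> /not_orP[Nf Ng].
have null h : continuous h -> mu [set x | h x = s] = 0%E ->
    mu (frontier [set x | s < h x]) = 0%E.
  move=> ch; apply: subset_measure0; first exact: frontier_measurable_rV.
    exact: level_measurable_rV.
  exact: frontier_superlevel.
exists s; first by rewrite se (lt_trans e20).
by split; apply: null => //; apply/eqP; apply: contrapT => /negP ?;
  [apply: Nf|apply: Ng].
Qed.

End null_levels.

(** The sets [{|x| > 1/(n+1)}] together with [{0}] cover the space; were they all null, [mu] would
    vanish. *)
Lemma exists_measure_norm_gt0 (R : realType) (d : nat)
    (mu : {measure set (borel_rV R d) -> \bar R}) :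
  mu [set 0] = 0%E -> mu [set: borel_rV R d] != 0%E ->
  exists2 e : R, 0 < e & (0 < mu [set x : 'rV[R]_d | (e < `|x|)%R])%E.
Proof.
move=> mu0 muT; apply: contrapT => H.
have mF e : measurable ([set x : 'rV[R]_d | (e < `|x|)%R] : set (borel_rV R d)).
  by apply: open_measurable_rV; apply: open_superlevel; exact: norm_continuous.
have m0 : measurable ([set 0 : 'rV[R]_d] : set (borel_rV R d)).
  rewrite (_ : [set 0] = [set x : 'rV[R]_d | `|x| = 0]).
    by apply: level_measurable_rV; exact: norm_continuous.
  by apply/seteqP; split=> x /= => [->|/normr0_eq0]; rewrite ?normr0.
move/eqP: muT; apply.
apply: (@subset_measure0 _ _ _ mu _
  ([set 0] `|` \bigcup_n [set x : 'rV[R]_d | (n.+1%:R^-1 < `|x|)%R])) => //.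
- by apply: measurableU => //; exact: bigcup_measurable.
- move=> x _; have [->|x0] := eqVneq (x : 'rV[R]_d) 0; first by left.
  right; exists (Num.truncn `|x : 'rV[R]_d|^-1) => //=.
  by rewrite invf_plt ?posrE ?normr_gt0// truncnS_gt.
- apply: etrans mu0; apply: measureU0 => //; first exact: bigcup_measurable.
  apply: measure_negligible; first exact: bigcup_measurable.
  apply: negligible_bigcup => n; apply/negligibleP => //; apply/eqP.
  rewrite eq_le measure_ge0 andbT leNgt; apply/negP => mun; apply: H.
  by exists n.+1%:R^-1.
Qed.

(** * Lower-tail events of uniform variables *)

Lemma uniform01_tail (disp : measure_display) (T : measurableType disp)
    (R : realType) (Pr : probability T R) (U : {RV Pr >-> R}) (p : R)
    (B : set R) : uniform01 U -> 0 < p <= 1 -> measurable B ->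
  [set` `]0, p[] `<=` B -> B `<=` [set` `]-oo, p]] -> Pr (U @^-1` B) = p%:E.
Proof.
move=> Uu /andP[p0 p1] mB sB Bs.
have := Uu _ mB; rewrite /distribution/= /pushforward => ->.
(* [B] cut down to [[0, 1]], where the density is 1, lies between []0, p[] and [[0, p]], both of
   length [p]. This treats [U < p], [U <= p] and [0 < U < p] at once. *)
have mBI : measurable (B `&` [set` `[0, 1]]) by exact: measurableI.
rewrite /uniform_prob integral_uniform_pdf.
rewrite (eq_integral (cst 1%E)); last first.
  by move=> x /set_mem[_ /=]; rewrite in_itv/= /uniform_pdf subr0 invr1 => ->.
rewrite integral_cst// mul1e; apply/eqP; rewrite eq_le; apply/andP; split.
- apply: (@le_trans _ _ (lebesgue_measure [set` `[0, p]])).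
    apply: measure_le => // x [/Bs/=]; rewrite !in_itv/= => xp /andP[-> _].
    exact: xp.
  by rewrite lebesgue_measure_itv/= lte_fin p0 -EFinB subr0.
- apply: (@le_trans _ _ (lebesgue_measure [set` `]0, p[])).
    by rewrite lebesgue_measure_itv/= lte_fin p0 -EFinB subr0.
  apply: measure_le => // x x0p; split; first exact: sB.
  move: x0p; rewrite /= !in_itv/= => /andP[/ltW -> xp].
  by rewrite (le_trans (ltW xp)).
Qed.

Section uniform_events.
Context (disp : measure_display) (T : measurableType disp) (R : realType)
  (Pr : probability T R).
Implicit Types (U V : {RV Pr >-> R}) (p : R).

Lemma measurable_RV_preimage U (B : set R) :
  measurable B -> measurable [set w | B (U w)].
Proof. exact: measurable_funPTI. Qed.

Lemma measurable_lt_event U p : measurable [set w | U w < p].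
Proof.
have := @measurable_RV_preimage U _ (measurable_itv `]-oo, p[).
by rewrite /preimage; under eq_fun do rewrite /= in_itv/=.
Qed.

Lemma measurable_le_event U p : measurable [set w | U w <= p].
Proof.
have := @measurable_RV_preimage U _ (measurable_itv `]-oo, p]).
by rewrite /preimage; under eq_fun do rewrite /= in_itv/=.
Qed.

Lemma measurable_oo_event U p : measurable [set w | 0 < U w < p].
Proof.
have := @measurable_RV_preimage U _ (measurable_itv `]0, p[).
by rewrite /preimage; under eq_fun do rewrite /= in_itv/=.
Qed.

Lemma uniform01_lt U p : uniform01 U -> 0 < p <= 1 ->
  Pr [set w | U w < p] = p%:E.
Proof.
move=> Uu p01.
rewrite -(@uniform01_tail _ _ _ _ U p [set` `]-oo, p[] Uu p01)//.
- by move=> x /=; rewrite !in_itv/= => /andP[].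
- by move=> x /=; rewrite !in_itv/=; exact: ltW.
Qed.

Lemma uniform01_le U p : uniform01 U -> 0 < p <= 1 ->
  Pr [set w | U w <= p] = p%:E.
Proof.
move=> Uu p01.
rewrite -(@uniform01_tail _ _ _ _ U p [set` `]-oo, p]] Uu p01)//.
- by move=> x /=; rewrite !in_itv/= => /andP[_ /ltW].
Qed.

Lemma uniform01_oo U p : uniform01 U -> 0 < p <= 1 ->
  Pr [set w | 0 < U w < p] = p%:E.
Proof.
move=> Uu p01.
rewrite -(@uniform01_tail _ _ _ _ U p [set` `]0, p[] Uu p01)//.
- by move=> x /=; rewrite !in_itv/= => /andP[_ /ltW].
Qed.

Lemma uniform01_le_oo U p : uniform01 U -> 0 < p <= 1 ->
  Pr ([set w | U w <= p] `\` [set w | 0 < U w < p]) = 0%E.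
Proof.
move=> Uu p01.
have mle := measurable_le_event U p; have moo := measurable_oo_event U p.
apply: etrans (measureD mle moo _) _.
  by rewrite [X in (X < _)%E](uniform01_le Uu p01) ltry.
rewrite [X in (X - _)%E](uniform01_le Uu p01).
rewrite setIidr; last by move=> w /= /andP[_ /ltW].
by rewrite [X in (_ - X)%E](uniform01_oo Uu p01) subee.
Qed.

(** Enlarging the right-hand event by the null sets [DU] and [DV] makes it cover the left-hand one.
    This reconciles the events [U <= p] of tail independence with the events [0 < U < p] that large
    Fréchet scores describe. *)
Lemma uniform01_le2_oo2 U V p : uniform01 U -> uniform01 V -> 0 < p <= 1 ->
  (Pr ([set w | (U w <= p)%R] `&` [set w | (V w <= p)%R]) <=
   Pr ([set w | (0 < U w < p)%R] `&` [set w | (0 < V w < p)%R]))%E.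
Proof.
move=> Uu Vu p01.
have mU := measurable_le_event U p; have mU' := measurable_oo_event U p.
have mV := measurable_le_event V p; have mV' := measurable_oo_event V p.
have mDU := measurableD mU mU'; have mDV := measurableD mV mV'.
have mI := measurableI _ _ mU' mV'.
have := uniform01_le_oo Vu p01; have := uniform01_le_oo Uu p01.
set DU := _ `\` _ => DU0; set DV := _ `\` _ => DV0.
rewrite -(@measureU0 _ _ _ Pr _ _ mI mDU DU0).
rewrite -(@measureU0 _ _ _ Pr _ _ (measurableU _ _ mI mDU) mDV DV0).
apply: measure_le; first exact: measurableI.
  by apply: measurableU => //; exact: measurableU.
move=> w [Uw Vw]; have [V0|V0] := pselect (0 < V w < p)%R; last by right.
by left; have [U0|U0] := pselect (0 < U w < p)%R; [left|right].
Qed.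

Lemma uniform01_oo2 U V p : uniform01 U -> uniform01 V -> 0 < p <= 1 ->
  Pr ([set w | 0 < U w < p] `&` [set w | 0 < V w < p]) =
  Pr ([set w | U w < p] `&` [set w | V w < p]).
Proof.
move=> Uu Vu p01; apply/eqP; rewrite eq_le; apply/andP; split.
- apply: measure_le.
  + by apply: measurableI; exact: measurable_oo_event.
  + by apply: measurableI; exact: measurable_lt_event.
  + by move=> w /= [/andP[_ ?] /andP[_ ?]].
- apply: le_trans (uniform01_le2_oo2 Uu Vu p01); apply: measure_le.
  + by apply: measurableI; exact: measurable_lt_event.
  + by apply: measurableI; exact: measurable_le_event.
  + by move=> w /= [/ltW ? /ltW].
Qed.

Lemma uniform01_le2 U V p : uniform01 U -> uniform01 V -> 0 < p <= 1 ->
  Pr ([set w | U w <= p] `&` [set w | V w <= p]) =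
  Pr ([set w | U w < p] `&` [set w | V w < p]).
Proof.
move=> Uu Vu p01; apply/eqP; rewrite eq_le -[X in (_ <= X)%E]uniform01_oo2//.
rewrite uniform01_le2_oo2//=; apply: measure_le.
- by apply: measurableI; exact: measurable_lt_event.
- by apply: measurableI; exact: measurable_le_event.
- by move=> w /= [/ltW ? /ltW].
Qed.

End uniform_events.

(** * Asymptotics of the Fréchet quantile and of the Šidák threshold *)

Section sidak.
Context (R : realType).
Implicit Types a p y : R.

Lemma bernoulli y n : -1 <= y -> 1 + y * n%:R <= (1 + y) ^+ n.
Proof.
move=> y1; elim: n => [|n IH]; first by rewrite mulr0 addr0 expr0.
have y0 : 0 <= 1 + y by rewrite -lerBlDl sub0r.
rewrite exprS; apply: le_trans (ler_wpM2l y0 IH).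
have n0 : 0 <= n%:R :> R by [].
rewrite -natr1; nra.
Qed.

(** [- ln (1 - p) = ln (1 + p / (1 - p))], and [ln (1 + x) <= x]. *)
Lemma ln1B_ge p : 0 < p < 1 -> - ln (1 - p) <= p / (1 - p).
Proof.
move=> /andP[p0 p1]; have q0 : 0 < 1 - p by rewrite subr_gt0.
rewrite -lnV ?posrE//.
have E : (1 - p)^-1 = 1 + p / (1 - p) by field; rewrite lt0r_neq0.
rewrite [X in ln X]E.
by apply: le_ln1Dx; rewrite (lt_trans (@ltrN10 R))// divr_gt0.
Qed.

(** Here [y] is any real, since a uniform variable may leave []0, 1[] on a null event. For [y >= 1]
    the conventions for [ln] and the inverse at 0 give quantile 0, and for [y <= 0] the quantile is
    at most 0, so neither exceeds a positive level. *)
Lemma frechet_quantile_gt_event p y : 0 < p < 1 ->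
  (frechet_quantile (1 - p) < frechet_quantile (1 - y)) = (0 < y < p).
Proof.
move=> /andP[p0 p1].
have lnp : 0 < - ln (1 - p)
  by rewrite oppr_gt0 ln_lt0// subr_gt0 p1 ltrBlDr ltrDl.
rewrite /frechet_quantile -!invrN; apply/idP/andP => [H|[y0 yp]].
- have lny : 0 < - ln (1 - y).
    by rewrite -invr_gt0 (lt_trans _ H)// invr_gt0.
  have y1 : y < 1.
    by rewrite -subr_gt0 ltNge; apply/negP => /ln0 E; move: lny;
      rewrite E oppr0 ltxx.
  move: H; rewrite ltf_pV2 ?posrE// ltrN2 ltr_ln ?posrE ?subr_gt0//.
  rewrite ltrD2l ltrN2 => ->; split=> //.
  rewrite ltNge; apply/negP => y0; move: lny; rewrite oppr_gt0 ltNge ln_ge0//.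
  by rewrite lerBrDr gerDl.
- have y1 : y < 1 by exact: (lt_trans yp p1).
  have lny : 0 < - ln (1 - y).
    by rewrite oppr_gt0 ln_lt0// subr_gt0 y1 ltrBlDr ltrDl.
  by rewrite ltf_pV2 ?posrE// ltrN2 ltr_ln ?posrE ?subr_gt0// ltrD2l ltrN2.
Qed.

(** The absolute value loses [0 < y]: slightly negative [y] give large negative quantiles. *)
Lemma normr_frechet_quantile_gt p y : 0 < p < 1 ->
  frechet_quantile (1 - p) < `|frechet_quantile (1 - y)| -> y < p.
Proof.
move=> p01; have /andP[p0 p1] := p01.
have q0 : 0 < frechet_quantile (1 - p).
  by apply: frechet_quantile_gt0; rewrite subr_gt0 p1 ltrBlDr ltrDl.
rewrite !ltNge; apply: contra => py.
have [y1|y1] := leP 1 y.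
  have := ln0 (x := 1 - y); rewrite subr_le0 => /(_ y1) E.
  by rewrite /frechet_quantile E invr0 oppr0 normr0 ltW.
rewrite ger0_norm; last first.
  apply/ltW/frechet_quantile_gt0; rewrite subr_gt0 y1 ltrBlDr ltrDl.
  exact: (lt_le_trans p0 py).
by rewrite leNgt frechet_quantile_gt_event// negb_and -!leNgt py orbT.
Qed.

Lemma frechet_quantile1B_cvg :
  frechet_quantile (1 - p) @[p --> (0 : R)^'+] --> +oo.
Proof.
apply/cvgryPge => A.
near=> p.
have p0 : 0 < p by near: p; exact: nbhs_right_gt.
have p1 : p < 1 by near: p; exact: nbhs_right_lt.
have q0 : 0 < 1 - p by rewrite subr_gt0.
(* This amounts to [(1 - p) / p > |A|], and the quantile is at least [(1 - p) / p] by [ln1B_ge]. *)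
have pA : p < (1 + `|A|)^-1.
  by near: p; apply: nbhs_right_lt; rewrite invr_gt0 ltr_pwDl.
rewrite /frechet_quantile -invrN.
apply: (@le_trans _ _ (p / (1 - p))^-1); last first.
  rewrite lef_pV2 ?posrE ?divr_gt0// ?ln1B_ge ?p0//.
  by rewrite oppr_gt0 ln_lt0// q0/= ltrBlDr ltrDl.
rewrite invf_div ler_pdivlMr// (@le_trans _ _ (`|A| * p))//.
  by rewrite ler_wpM2r ?ler_norm// ltW.
have : p * (1 + `|A|) <= 1 by rewrite -ler_pdivlMr ?ltr_pwDl// mul1r ltW.
by rewrite mulrDr mulr1 mulrC lerBrDr addrC.

Unshelve. all: by end_near. Qed.

(** Bernoulli's inequality for [z = (1 - a)^(1/d)] reads [1 + d * (z - 1) <= z ^ d = 1 - a]. *)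
Lemma sidak_threshold_ge (d : nat) a : (0 < d)%N -> 0 < a < 1 ->
  a / d%:R <= sidak_threshold d a.
Proof.
move=> d0 /andP[a0 a1]; have d0' : 0 < d%:R :> R by rewrite ltr0n.
rewrite ler_pdivrMr// /sidak_threshold.
set z := expR _.
have zd : z ^+ d = 1 - a.
  by rewrite -expRM_natr mulrAC mulVf ?gt_eqF// mul1r lnK// posrE subr_gt0.
have : 1 + (z - 1) * d%:R <= z ^+ d.
  by rewrite -[in leRHS](subrKC 1 z) bernoulli// lerBrDl subrr expR_ge0.
by rewrite zd lerD2l -lerN2 opprK -mulNr opprB.
Qed.

(** From [exp x >= 1 + x] at [x = ln (1 - a) / d], followed by [ln1B_ge]. *)
Lemma sidak_threshold_le (d : nat) a : (0 < d)%N -> 0 < a < 1 ->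
  sidak_threshold d a <= a / (1 - a) / d%:R.
Proof.
move=> d0 a01; have d0' : 0 < d%:R :> R by rewrite ltr0n.
rewrite /sidak_threshold lerBlDr -lerBlDl.
apply: le_trans (expR_ge1Dx _).
rewrite lerD2l -lerN2 opprK -mulrN mulrC ler_pM2r ?invr_gt0//.
exact: ln1B_ge.
Qed.

Lemma sidak_threshold_near (d : nat) (e : R) : (0 < d)%N -> 0 < e ->
  \forall a \near (0 : R)^'+, [/\ 0 < a, 0 < sidak_threshold d a < 1,
    a <= d%:R * sidak_threshold d a &
    d%:R * sidak_threshold d a <= (1 + e) * a].
Proof.
move=> d0 e0; have d0' : 0 < d%:R :> R by rewrite ltr0n.
have e1 : 0 < 1 + e by exact: addr_gt0.
near=> a.
have a0 : 0 < a by near: a; exact: nbhs_right_gt.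
(* This ensures [1 / (1 - a) <= 1 + e]. *)
have ae : a < e / (1 + e) by near: a; apply: nbhs_right_lt; exact: divr_gt0.
have a1 : a < 1 by rewrite (lt_trans ae)// ltr_pdivrMr// mul1r ltrDr.
have a01 : 0 < a < 1 by rewrite a0.
have tge := sidak_threshold_ge d0 a01; have tle := sidak_threshold_le d0 a01.
split=> //.
- rewrite (lt_le_trans _ tge) ?divr_gt0//= /sidak_threshold.
  by rewrite ltrBlDr ltrDl expR_gt0.
- by rewrite mulrC -ler_pdivrMr.
- rewrite mulrC -ler_pdivlMr// (le_trans tle)// ler_pM2r ?invr_gt0//.
  rewrite ler_pdivrMr ?subr_gt0//.
  by move: ae; rewrite ltr_pdivlMr// => ae; nra.
Unshelve. all: by end_near. Qed.

(** The threshold tends to 0 from the right, because [0 < t <= d * t <= 2 * a]. *)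
Lemma near_sidak_threshold (d : nat) (Q : set R) : (0 < d)%N ->
  (\forall p \near (0 : R)^'+, Q p) ->
  \forall a \near (0 : R)^'+, Q (sidak_threshold d a).
Proof.
move=> d0 [r /= r0 Qr]; near=> a.
have [a0 /andP[t0 _] _ ta] : [/\ 0 < a, 0 < sidak_threshold d a < 1,
    a <= d%:R * sidak_threshold d a &
    d%:R * sidak_threshold d a <= (1 + 1) * a].
  by near: a; exact: sidak_threshold_near.
have ar : a < r / 2 by near: a; apply: nbhs_right_lt; rewrite divr_gt0.
have d1 : 1 <= d%:R :> R by rewrite ler1n.
apply: Qr => //=; rewrite sub0r normrN gtr0_norm//.
move: ar; rewrite ltr_pdivlMr//; nra.
Unshelve. all: by end_near. Qed.

End sidak.

(** * Bounding an upper limit by eventual inequalities *)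

Section limf_esup_bounds.
Context (T : choiceType) (X : filteredType T) (R : realType).
Implicit Types (f : X -> \bar R) (F : set_system X) (M : \bar R).

Lemma limf_esup_le f F M : (\forall x \near F, (f x <= M)%E) ->
  (limf_esup f F <= M)%E.
Proof.
move=> FM; rewrite limf_esupE; apply: (@le_trans _ _
  (ereal_sup [set f x | x in [set x | (f x <= M)%E]])).
  by apply: ereal_inf_lbound; exists [set x | (f x <= M)%E].
by apply: ge_ereal_sup => _ [x /= fx <-].
Qed.

Lemma limf_esup_ge f F M : ProperFilter F ->
  (\forall x \near F, (M <= f x)%E) ->
  (M <= limf_esup f F)%E.
Proof.
move=> PF FM; rewrite limf_esupE; apply: le_ereal_inf_tmp => _ [V FV <-].
have [x [/= Mf Vx]] := filter_ex (filterI FM FV).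
by apply: (le_trans Mf); apply: ereal_sup_ubound; exists x.
Qed.

End limf_esup_bounds.

(** * Union bounds and Bonferroni inequalities *)

Section bonferroni.
Context (disp : measure_display) (T : measurableType disp) (R : realType)
  (Pr : probability T R).
Local Notation m A := (fine (Pr A)).

Lemma fine_probability_le (A B : set T) : measurable A -> measurable B ->
  A `<=` B -> m A <= m B.
Proof.
move=> mA mB AB; apply: fine_le; rewrite ?fin_num_measure//.
exact: measure_le.
Qed.

Lemma fine_probabilityU (A B : set T) : measurable A -> measurable B ->
  m (A `|` B) = m A + m B - m (A `&` B).
Proof.
move=> mA mB; have mI := measurableI _ _ mA mB.
have : Pr (A `|` B) = (Pr A + Pr B - Pr (A `&` B))%E.
  by apply: measureUfinl => //; rewrite ltey_eq fin_num_measure.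
by move=> ->; rewrite fineB ?fin_numD ?fin_num_measure// fineD ?fin_num_measure.
Qed.

(** [A = setT] is the plain union bound; general [A] bounds the overlap of one event with the union
    of the others. *)
Lemma fine_probability_bigsetU_le (I : Type) (s : seq I) (Q : pred I)
    (E : I -> set T) (A : set T) :
  measurable A -> (forall k, measurable (E k)) ->
  m (A `&` \big[setU/set0]_(k <- s | Q k) E k) <=
  \sum_(k <- s | Q k) m (A `&` E k).
Proof.
move=> mA mE; elim: s => [|x s IH]; first by rewrite !big_nil setI0 measure0.
rewrite !big_cons; case: ifP => // Qx.
have mU : measurable (\big[setU/set0]_(k <- s | Q k) E k).
  exact: bigsetU_measurable.
rewrite setIUr fine_probabilityU; [|exact: measurableI|exact: measurableI].
rewrite -addrA lerD2l (le_trans _ IH)// lerBlDr lerDl.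
exact: fine_ge0.
Qed.

(** Adding an event to [n] others costs an overlap of at most [n * c], which the increment
    [((n+1)^2 - n^2) * c] absorbs; the square replaces the sharper binomial coefficient. *)
Lemma fine_probability_bigsetU_ge (I : eqType) (s : seq I)
    (E : I -> set T) (c : R) : uniq s -> 0 <= c ->
  (forall k, measurable (E k)) ->
  (forall k l, k != l -> m (E k `&` E l) <= c) ->
  \sum_(k <- s) m (E k) <=
  m (\big[setU/set0]_(k <- s) E k) + (size s)%:R ^+ 2 * c.
Proof.
move=> + c0 mE Ec; elim: s => [|x s IH].
  by rewrite !big_nil measure0 expr0n mul0r addr0.
move=> /=/andP[xs us]; rewrite !big_cons.
have mU : measurable (\big[setU/set0]_(k <- s) E k).
  exact: bigsetU_measurable.
rewrite fine_probabilityU//.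
have : m (E x `&` \big[setU/set0]_(k <- s) E k) <= (size s)%:R * c.
  apply: le_trans (fine_probability_bigsetU_le _ _ _ _) _ => //.
  rewrite big_seq (le_trans (_ : _ <= \sum_(k <- s | k \in s) c))//.
    apply: ler_sum => k ks; apply: Ec; apply: contraNneq xs => ->; exact: ks.
  by rewrite -big_seq big_const_seq count_predT iter_addr_0 mulr_natl.
have := IH us; rewrite -natr1; set n := _%:R.
have : 0 <= n :> R by [].
nra.
Qed.

(** Inclusion-exclusion is exact for the pair [i], [j]; the union bound handles the remaining
    events. *)
Lemma fine_probability_bigsetU_lt (I : finType) (E : I -> set T) (i j : I) :
  i != j -> (forall k, measurable (E k)) ->
  m (\big[setU/set0]_k E k) <= \sum_k m (E k) - m (E i `&` E j).
Proof.
move=> ij mE; have ji : j != i by rewrite eq_sym.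
rewrite (bigD1 i)//= (bigD1 j)//= setUA [in leRHS](bigD1 i)//=.
rewrite [in leRHS](bigD1 j)//=.
have mU : measurable (\big[setU/set0]_(k | (k != i) && (k != j)) E k).
  exact: bigsetU_measurable.
have mEij : measurable (E i `|` E j) by exact: measurableU.
rewrite fine_probabilityU// fine_probabilityU//.
have := fine_probability_bigsetU_le (index_enum I)
  (fun k => (k != i) && (k != j)) measurableT mE.
rewrite setTI [X in _ <= X](eq_bigr (fun k => m (E k))); last first.
  by move=> k _; rewrite setTI.
have : 0 <= m ((E i `|` E j) `&`
    \big[setU/set0]_(k | (k != i) && (k != j)) E k).
  exact: fine_ge0.
lra.
Qed.

End bonferroni.

(** * The rejection event as a union; homogeneous functions and the sup norm *)

Lemma tippett_rejectE (T : Type) (R : realType) (d : nat) (P : 'I_d -> T -> R)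
    (a : R) : (0 < d)%N ->
  tippett_reject P a =
  \big[setU/set0]_(i < d) [set w | P i w < sidak_threshold d a].
Proof.
move=> d0; rewrite -bigcup_seq; apply/seteqP; split=> w /=.
- rewrite /tippett_reject/= /pmin => H; have [|_ [i _ <-] iH] := inf_lt _ H.
    by exists (P (Ordinal d0) w); exists (Ordinal d0).
  by exists i => //=; rewrite mem_index_enum.
- move=> [i _ /= iw]; apply: le_lt_trans iw; apply: ge_inf; last by exists i.
  (* A lower bound of the range, so that its infimum is below each of its elements. *)
  exists (- \sum_k `|P k w|) => _ [k _ <-].
  rewrite lerNl (le_trans (ler_norm _))// normrN (bigD1 k)//= lerDl.
  exact: sumr_ge0.
Qed.

Lemma dilate_superlevel (R : realType) (d : nat) (f : 'rV[R]_d -> R) (s t : R) :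
  (forall a x, 0 < a -> f (a *: x) = a * f x) -> 0 < t ->
  dilate t [set x | s < f x] = [set x | t * s < f x].
Proof.
move=> fZ t0; apply/seteqP; split=> [_ [x /= sx <-]|x /= tsx].
  by rewrite /= fZ// ltr_pM2l.
exists (t^-1 *: x); last by rewrite scalerA divff ?scale1r// gt_eqF.
by rewrite /= fZ ?invr_gt0// ltr_pdivlMl.
Qed.

Lemma ler_coord_norm (R : realType) (d : nat) (x : 'rV[R]_d) (k : 'I_d) :
  `|x ord0 k| <= `|x|.
Proof.
rewrite [leRHS]mx_normrE.
by apply: le_trans (le_bigmax _ _ (ord0, k)).
Qed.

Lemma norm_gt_coord (R : realType) (d : nat) (x : 'rV[R]_d) (u : R) :
  0 <= u -> u < `|x| -> exists k, u < `|x ord0 k|.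
Proof.
move=> u0 ux; have /mx_norm_neq0[[i k] /= xE] : `|x| != 0.
  by rewrite gt_eqF// (le_lt_trans u0).
by exists k; move: ux; rewrite [ltRHS]xE (ord1 i).
Qed.

(** * Joint tail relative to the tail of the norm *)

Section tail_ratio.
Context (R : realType) (disp : measure_display) (T : measurableType disp)
  (Pr : probability T R) (d : nat).
Variables (P : 'I_d -> {RV Pr >-> R}) (X : {RV Pr >-> borel_rV R d}).
Hypothesis P_unif : forall i, uniform01 (P i).
Hypothesis X_def : forall (w : T) (i : 'I_d),
  (X w : 'rV[R]_d) ord0 i = frechet_quantile (1 - P i w).
Implicit Types (p : R) (i j : 'I_d).

Local Notation E i p := [set w | P i w < p].
Local Notation N p :=
  [set w | frechet_quantile (1 - p) < `|(X w : 'rV[R]_d)|].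

Let fq_gt0 p : 0 < p < 1 -> 0 < frechet_quantile (1 - p).
Proof.
move=> /andP[p0 p1]; apply: frechet_quantile_gt0.
by rewrite subr_gt0 p1 ltrBlDr ltrDl.
Qed.

Lemma measurable_superlevel_event (h : 'rV[R]_d -> R) (u : R) :
  continuous h -> measurable [set w | u < h (X w)].
Proof.
move=> ch; apply: (@measurable_funPTI _ _ _ _ X [set x : 'rV[R]_d | u < h x]).
by apply: open_measurable_rV; exact: open_superlevel.
Qed.

Lemma norm_tail_ge p i : 0 < p < 1 -> p <= fine (Pr (N p)).
Proof.
move=> p01; have /andP[p0 p1] := p01.
have E0 : p = fine (Pr [set w | 0 < P i w < p]).
  by rewrite uniform01_oo// p0 ltW.
rewrite [leLHS]E0.
apply: fine_probability_le.
- exact: measurable_oo_event.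
- by apply: measurable_superlevel_event; exact: norm_continuous.
- move=> w /= wp; rewrite /=.
  apply: (lt_le_trans _ (ler_coord_norm _ i)); rewrite X_def.
  apply: (lt_le_trans _ (ler_norm _)).
  by rewrite frechet_quantile_gt_event.
Qed.

(** A large sup norm comes from some coordinate [k], which forces [P k w < p]; then the union bound
    applies. *)
Lemma norm_tail_le p : 0 < p < 1 -> fine (Pr (N p)) <= d%:R * p.
Proof.
move=> p01; have /andP[p0 p1] := p01.
have mE k : measurable (E k p) by exact: measurable_lt_event.
apply: (@le_trans _ _ (fine (Pr (\big[setU/set0]_(k < d) E k p)))).
  apply: fine_probability_le.
  - by apply: measurable_superlevel_event; exact: norm_continuous.
  - exact: bigsetU_measurable.
  - move=> w /= /norm_gt_coord => /(_ (ltW (fq_gt0 p01)))[k].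
    rewrite X_def => /(normr_frechet_quantile_gt p01) wp.
    by rewrite -bigcup_seq; exists k => //=; rewrite mem_index_enum.
have := fine_probability_bigsetU_le Pr (index_enum 'I_d) xpredT measurableT mE.
rewrite setTI => /le_trans; apply.
rewrite (eq_bigr (fun=> p)).
  by rewrite big_const_ord iter_addr_0 mulr_natl.
by move=> k _; rewrite setTI uniform01_lt// p0 ltW.
Qed.

Lemma joint_tail_event p i j : 0 < p < 1 ->
  [set w | frechet_quantile (1 - p) <
    Num.min ((X w : 'rV[R]_d) ord0 i) ((X w : 'rV[R]_d) ord0 j)] =
  [set w | 0 < P i w < p] `&` [set w | 0 < P j w < p].
Proof.
move=> p01; apply/seteqP; split=> w /=.
  by rewrite lt_min !X_def !frechet_quantile_gt_event// => /andP.
by move=> [iw jw]; rewrite lt_min !X_def !frechet_quantile_gt_event// iw.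
Qed.

Lemma joint_tail_ratio_cvg i j : multivariate_regularly_varying X ->
  exists l : R,
    fine (Pr (E i p `&` E j p)) / fine (Pr (N p)) @[p --> 0^'+] --> l.
Proof.
move=> [b [mu [b0 [_ [mu0 [muT [mufin cvgA]]]]]]].
have [e e0 mue] := exists_measure_norm_gt0 mu0 muT.
pose f (x : 'rV[R]_d) := `|x|.
pose g (x : 'rV[R]_d) := Num.min (x ord0 i) (x ord0 j).
have cf : continuous f by exact: norm_continuous.
have cg : continuous g.
  by move=> x; apply: continuous_min; exact: coord_continuous.
have gle x : g x <= `|x|.
  by rewrite /g ge_min (le_trans (ler_norm _) (ler_coord_norm _ _)).
have [s /andP[s0 se] [nf ng]] :=
  common_null_frontier mufin e0 cf cg (fun=> lexx _) gle.
pose C := [set x | s < f x]; pose A := [set x | s < g x].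
have mC : measurable (C : set (borel_rV R d)).
  by apply: open_measurable_rV; exact: open_superlevel.
have mA : measurable (A : set (borel_rV R d)).
  by apply: open_measurable_rV; exact: open_superlevel.
have bC : bounded_away_from0 C by exists s => // x /ltW.
have bA : bounded_away_from0 A.
  by exists s => // x /= /ltW /le_trans; apply; exact: gle.
have muC : mu C \is a fin_num by rewrite ge0_fin_numE// mufin.
have muA : mu A \is a fin_num by rewrite ge0_fin_numE// mufin.
have muC0 : (0 < mu C)%E.
  (* Since [s < e], [C] contains the set [{|x| > e}] of positive mass. *)
  apply: (lt_le_trans mue); apply: measure_le => //.
    by apply: open_measurable_rV; exact: open_superlevel.
  by move=> x /=; exact: lt_trans.
pose tau p := frechet_quantile (1 - p) * s^-1.
have tauy : tau p @[p --> 0^'+] --> +oo.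
  apply: gt0_cvgMly; [by rewrite invr_gt0|exact: frechet_quantile1B_cvg].
(* For homogeneous [h], dilating [{h > s}] by [tau p] gives [{h > frechet_quantile (1 - p)}]; used
   for the norm and for the minimum. *)
have lim (h : 'rV[R]_d -> R) : continuous h ->
    (forall a x, 0 < a -> h (a *: x) = a * h x) ->
    mu [set x | s < h x] \is a fin_num ->
    ((b t)%:E * Pr (X @^-1` dilate t [set x | (s < h x)%R]))%E @[t --> +oo] -->
      mu [set x | s < h x] ->
    b (tau p) * fine (Pr [set w | frechet_quantile (1 - p) < h (X w)])
      @[p --> 0^'+] --> fine (mu [set x | s < h x]).
  move=> ch hZ muh cvgh; have H := cvg_comp tau _ tauy cvgh.
  rewrite -(fineK muh) in H; apply: cvg_trans (fine_cvg H).
  apply: near_eq_cvg; near=> p.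
  have p01 : 0 < p < 1.
    by apply/andP; split; near: p; [exact: nbhs_right_gt|exact: nbhs_right_lt].
  have t0 : 0 < tau p by rewrite divr_gt0// fq_gt0.
  rewrite /= dilate_superlevel// mulfVK ?gt_eqF//.
  by rewrite fineM// fin_num_measure//; exact: measurable_superlevel_event.
have fZ a x : 0 < a -> f (a *: x) = a * f x.
  by move=> a0; rewrite /f normrZ gtr0_norm.
have gZ a x : 0 < a -> g (a *: x) = a * g x.
  by move=> a0; rewrite /g !mxE minr_pMr// ltW.
have limC := lim f cf fZ muC (cvgA C mC bC nf).
have limA := lim g cg gZ muA (cvgA A mA bA ng).
exists (fine (mu A) / fine (mu C)).
have c0 : fine (mu C) != 0 by rewrite gt_eqF// fine_gt0// muC0 -ge0_fin_numE.
apply: cvg_trans (cvgM limA (cvgV c0 limC)).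
apply: near_eq_cvg; near=> p.
have p01 : 0 < p < 1.
  by apply/andP; split; near: p; [exact: nbhs_right_gt|exact: nbhs_right_lt].
have t0 : 0 < tau p by rewrite divr_gt0// fq_gt0.
have /andP[p0 p1] := p01.
rewrite /= joint_tail_event// uniform01_oo2 ?p0 ?ltW//.
(* The common factor [b (tau p)] is positive and cancels. *)
by rewrite invfM mulrACA divff ?mul1r// gt_eqF// b0.
Unshelve. all: by end_near. Qed.

End tail_ratio.

(** * Tail independence or a joint tail of linear order *)

Lemma lower_tail_independentP (R : realType) (disp : measure_display)
    (T : measurableType disp) (Pr : probability T R) (U V : {RV Pr >-> R}) :
  uniform01 U -> uniform01 V ->
  lower_tail_independent U V <-> forall e, 0 < e -> \forall p \near 0^'+,
    fine (Pr ([set w | (U w < p)%R] `&` [set w | (V w < p)%R])) <= e * p.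
Proof.
move=> Uu Vu.
have condE p : 0 < p <= 1 ->
    cond_prob Pr [set w | U w <= p] [set w | V w <= p] =
    fine (Pr ([set w | U w < p] `&` [set w | V w < p])) / p.
  by move=> p01; rewrite /cond_prob uniform01_le2// uniform01_le.
split=> [/cvgrPdist_le H e e0|H].
- have {}H := H e e0; near=> p.
  have p0 : 0 < p by near: p; exact: nbhs_right_gt.
  have p1 : p <= 1 by near: p; exact: nbhs_right_le.
  rewrite -ler_pdivrMr// -condE ?p0//.
  apply: le_trans (ler_norm _) _; rewrite -normrN -sub0r.
  by near: p.
- apply/cvgrPdist_le => e e0; have {}H := H e e0; near=> p.
  have p0 : 0 < p by near: p; exact: nbhs_right_gt.
  have p1 : p <= 1 by near: p; exact: nbhs_right_le.
  rewrite sub0r normrN condE ?p0// ger0_norm.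
    by rewrite ler_pdivrMr//; near: p.
  by rewrite divr_ge0 ?fine_ge0// ltW.
Unshelve. all: by end_near. Qed.

(** The sign of the limiting ratio [l] decides. If [l > 0], the ratio eventually exceeds [l / 2] and
    its denominator is at least [p]; otherwise it falls below [e / d] and its denominator is at most
    [d * p]. *)
Lemma lower_tail_dichotomy (R : realType) (disp : measure_display)
    (T : measurableType disp) (Pr : probability T R) (d : nat)
    (P : 'I_d -> {RV Pr >-> R}) (X : {RV Pr >-> borel_rV R d}) (i j : 'I_d) :
  (forall i, uniform01 (P i)) ->
  (forall (w : T) (i : 'I_d),
    (X w : 'rV[R]_d) ord0 i = frechet_quantile (1 - P i w)) ->
  multivariate_regularly_varying X ->
  lower_tail_independent (P i) (P j) \/
  exists2 c : R, 0 < c & \forall p \near 0^'+,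
    c * p <= fine (Pr ([set w | (P i w < p)%R] `&` [set w | (P j w < p)%R])).
Proof.
move=> P_unif X_def X_mrv.
have [l ratio] := joint_tail_ratio_cvg P_unif X_def i j X_mrv.
have d0 : 0 < d%:R :> R by rewrite ltr0n (leq_ltn_trans _ (ltn_ord i)).
have [l0|l0] := ltP 0 l.
- right; exists (l / 2); first by rewrite divr_gt0.
  have l2 : l / 2 < l by rewrite ltr_pdivrMr// ltr_pMr// ltr1n.
  have {}ratio := cvgr_gt _ ratio _ l2.
  near=> p.
  have p01 : 0 < p < 1.
    by apply/andP; split; near: p; [exact: nbhs_right_gt|exact: nbhs_right_lt].
  have pN := norm_tail_ge P_unif X_def i p01; have /andP[p0 _] := p01.
  have : l / 2 < fine (Pr ([set w | P i w < p] `&` [set w | P j w < p])) /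
      fine (Pr [set w | frechet_quantile (1 - p) < `|(X w : 'rV[R]_d)|]).
    by near: p; exact: ratio.
  rewrite ltr_pdivlMr ?(lt_le_trans p0)// => /ltW; apply: le_trans.
  by rewrite ler_pM2l// divr_gt0.
- left; apply/lower_tail_independentP => // e e0.
  have le : l < e / d%:R by rewrite (le_lt_trans l0)// divr_gt0.
  have {}ratio := cvgr_lt _ ratio _ le.
  near=> p.
  have p01 : 0 < p < 1.
    by apply/andP; split; near: p; [exact: nbhs_right_gt|exact: nbhs_right_lt].
  have pN := norm_tail_ge P_unif X_def i p01; have /andP[p0 _] := p01.
  have Np := norm_tail_le P_unif X_def p01.
  have : fine (Pr ([set w | P i w < p] `&` [set w | P j w < p])) /
      fine (Pr [set w | frechet_quantile (1 - p) < `|(X w : 'rV[R]_d)|]) <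
      e / d%:R.
    by near: p; exact: ratio.
  rewrite ltr_pdivrMr ?(lt_le_trans p0)// => /ltW/le_trans; apply.
  by rewrite -mulrA ler_pM2l// ler_pdivrMl.
Unshelve. all: by end_near. Qed.

(** * Asymptotic size of Tippett's test *)

Section tippett.
Context (R : realType) (disp : measure_display) (T : measurableType disp)
  (Pr : probability T R) (d : nat) (P : 'I_d -> {RV Pr >-> R}).
Hypotheses (d_gt0 : (0 < d)%N) (P_unif : forall i, uniform01 (P i)).
Local Notation E i p := [set w | P i w < p].
Local Notation size a := (fine (Pr (tippett_reject P a))).

Let mE p i : measurable (E i p). Proof. exact: measurable_lt_event. Qed.

Let measurable_reject a : measurable (tippett_reject P a).
Proof. by rewrite tippett_rejectE//; exact: bigsetU_measurable. Qed.

Let sum_tail p : 0 < p < 1 -> \sum_(i < d) fine (Pr (E i p)) = d%:R * p.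
Proof.
move=> /andP[p0 p1]; rewrite (eq_bigr (fun=> p)).
  by rewrite big_const_ord iter_addr_0 mulr_natl.
by move=> k _; rewrite uniform01_lt// p0 ltW.
Qed.

Lemma tippett_relative_size_le (c : R) :
  (\forall a \near 0^'+, size a <= c * a) ->
  (relative_size Pr (tippett_reject P) <= c%:E)%E.
Proof.
move=> sizec; apply: limf_esup_le; near=> a.
have a0 : 0 < a by near: a; exact: nbhs_right_gt.
rewrite -[Pr _]fineK ?fin_num_measure// -EFinM lee_fin ler_pdivrMl// mulrC.
by near: a.
Unshelve. all: by end_near. Qed.

Lemma tippett_relative_size_ge (c : R) :
  (\forall a \near 0^'+, c * a <= size a) ->
  (c%:E <= relative_size Pr (tippett_reject P))%E.
Proof.
move=> sizec; apply: limf_esup_ge; near=> a.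
have a0 : 0 < a by near: a; exact: nbhs_right_gt.
rewrite -[Pr _]fineK ?fin_num_measure// -EFinM lee_fin ler_pdivlMl// mulrC.
by near: a.
Unshelve. all: by end_near. Qed.

Lemma tippett_honest : honest Pr (tippett_reject P).
Proof.
apply/lee_addgt0Pr => e e0; rewrite -EFinD.
apply: tippett_relative_size_le; near=> a.
have [a0 t01 _ ta] : [/\ 0 < a, 0 < sidak_threshold d a < 1,
    a <= d%:R * sidak_threshold d a &
    d%:R * sidak_threshold d a <= (1 + e) * a].
  by near: a; exact: sidak_threshold_near.
apply: le_trans ta; rewrite tippett_rejectE// -sum_tail//.
have := fine_probability_bigsetU_le Pr (index_enum 'I_d) xpredT measurableT
  (mE (sidak_threshold d a)).
by rewrite setTI => /le_trans; apply; apply: ler_sum => k _; rewrite setTI.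
Unshelve. all: by end_near. Qed.

Lemma tippett_conservative (i j : 'I_d) (c : R) : i != j -> 0 < c ->
  (\forall p \near 0^'+, c * p <= fine (Pr (E i p `&` E j p))) ->
  conservative Pr (tippett_reject P).
Proof.
move=> ij c0 Hc; have d0 : 0 < d%:R :> R by rewrite ltr0n.
have cd0 : 0 < c / d%:R by rewrite divr_gt0.
have e0 : 0 < c / d%:R / 2 by rewrite divr_gt0.
(* With [t] the threshold, the size is at most [d * t - c * t]. Here
   [d * t <= (1 + c / (2 * d)) * a] and [c * t >= (c / d) * a], which leaves [1 - c / (2 * d)]. *)
apply: (@le_lt_trans _ _ (1 - c / d%:R / 2)%:E); last first.
  by rewrite lte_fin gtrBl.
apply: tippett_relative_size_le; near=> a.
have [a0 t01 at_ ta] : [/\ 0 < a, 0 < sidak_threshold d a < 1,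
    a <= d%:R * sidak_threshold d a &
    d%:R * sidak_threshold d a <= (1 + c / d%:R / 2) * a].
  by near: a; exact: sidak_threshold_near.
have ct : c * sidak_threshold d a <=
    fine (Pr (E i (sidak_threshold d a) `&` E j (sidak_threshold d a))).
  by near: a; exact: near_sidak_threshold d_gt0 Hc.
have := fine_probability_bigsetU_lt Pr ij (mE (sidak_threshold d a)).
rewrite -tippett_rejectE// sum_tail//.
have : c / d%:R * a <= c * sidak_threshold d a.
  by rewrite -mulrA ler_pM2l// ler_pdivrMl.
lra.
Unshelve. all: by end_near. Qed.

Lemma tippett_relative_size_ge1 :
  (forall i j : 'I_d, i != j -> lower_tail_independent (P i) (P j)) ->
  (1 <= relative_size Pr (tippett_reject P))%E.
Proof.
move=> lti; apply/lee_addgt0Pr => e e0; rewrite -leeBlDr// -EFinB.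
apply: tippett_relative_size_ge.
(* The Bonferroni error [d^2 * r * t] becomes [e * t / 2], at most [e * a] because [t <= 2 * a]. *)
pose r : R := e / (2 * d%:R ^+ 2).
have d1 : 1 <= d%:R :> R by rewrite ler1n.
have d0 : 0 < d%:R :> R by rewrite ltr0n.
have r0 : 0 < r by rewrite divr_gt0// mulr_gt0// exprn_gt0.
(* Finitely many pairs share one neighbourhood of 0. *)
have rP : \forall p \near (0 : R)^'+, forall ij : 'I_d * 'I_d, ij.1 != ij.2 ->
    fine (Pr (E ij.1 p `&` E ij.2 p)) <= r * p.
  apply: filter_forall => -[i j] /=; case: eqVneq => [_|ij].
    by near=> p.
  have /lower_tail_independentP := lti i j ij =>
    /(_ (P_unif i) (P_unif j) r r0).
  by apply: filterS => p.
near=> a.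
have [a0 t01 at_ ta] : [/\ 0 < a, 0 < sidak_threshold d a < 1,
    a <= d%:R * sidak_threshold d a &
    d%:R * sidak_threshold d a <= (1 + 1) * a].
  by near: a; exact: sidak_threshold_near.
have rt : forall ij : 'I_d * 'I_d, ij.1 != ij.2 ->
    fine (Pr (E ij.1 (sidak_threshold d a) `&` E ij.2 (sidak_threshold d a))) <=
    r * sidak_threshold d a.
  by near: a; exact: near_sidak_threshold d_gt0 rP.
have /andP[t0 _] := t01.
have := @fine_probability_bigsetU_ge _ _ _ Pr _ (index_enum 'I_d)
  (fun k => E k (sidak_threshold d a)) (r * sidak_threshold d a)
  _ _ (mE _) (fun k l => rt (k, l)).
rewrite -tippett_rejectE// sum_tail// =>
  /(_ (index_enum_uniq _) (mulr_ge0 (ltW r0) (ltW t0))).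
have -> : seq.size (index_enum 'I_d) = d.
  by rewrite -sum1_size big_const_ord iter_addn_0 mul1n.
have -> : d%:R ^+ 2 * (r * sidak_threshold d a) = e * (sidak_threshold d a / 2).
  by rewrite /r; field; rewrite gt_eqF.
have : e * (sidak_threshold d a / 2) <= e * a by rewrite ler_pM2l//; nra.
lra.
Unshelve. all: by end_near. Qed.

End tippett.

Theorem corollary4 (R : realType) (disp : measure_display)
    (T : measurableType disp) (Pr : probability T R)
    (d : nat) (d_gt0 : (0 < d)%N)
    (P : 'I_d -> {RV Pr >-> R}) (P_unif : forall i, uniform01 (P i))
    (X : {RV Pr >-> borel_rV R d})
    (X_def : forall (w : T) (i : 'I_d),
       (X w : 'rV[R]_d) ord0 i = frechet_quantile (1 - P i w))
    (X_mrv : multivariate_regularly_varying X) :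
  honest Pr (tippett_reject P) /\
  (conservative Pr (tippett_reject P) <->
   ~ (forall i j : 'I_d, i != j -> lower_tail_independent (P i) (P j))).
Proof.
split; first exact: tippett_honest.
(* For [d = 1] there are no pairs: tail independence is vacuous and the test is not conservative. *)
split=> [cons lti|Nlti].
  by have := tippett_relative_size_ge1 d_gt0 P_unif lti; rewrite leNgt cons.
move: Nlti => /existsNP[i /existsNP[j /not_implyP[ij Nij]]].
have [//|[c c0 cP]] := lower_tail_dichotomy i j P_unif X_def X_mrv.
exact: tippett_conservative ij c0 cP.
Qed.
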